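(* There exist infinitely many integers $n \ge 1$ having a convergent trajectory (under the $3x+1$ function $T$) whose ones-ratio satisfies $\rho(n) \ge \frac{14}{29}$. Thus there is an infinite set of positive integers $n$ such that $\gamma(n)$ is finite and $$\gamma(n) \;\ge\; \frac{29}{29\log 2 - 14\log 3} \approx 6.14316 .$$
   Context: The $3x+1$ function $T:\mathbb{Z}\to\mathbb{Z}$ is $T(n)=n/2$ if $n$ is even and $T(n)=(3n+1)/2$ if $n$ is odd; $T^{(k)}$ denotes its $k$-th iterate, and $\log$ is the natural logarithm. For a positive integer $n$ the total stopping time $\sigma_\infty(n)$ is the minimal $k$ such that $T^{(k)}(n)=1$, with $\sigma_\infty(n)=\infty$ if no such $k$ exists. The trajectory of $n$ is convergent if $\sigma_\infty(n)<\infty$. The stopping time ratio is $\gamma(n)=\sigma_\infty(n)/\log n$ (for $n\ge 2$). For $n \ge 2$ with convergent trajectory and $k=\sigma_\infty(n)$, the ones-ratio is $$\rho(n)=\frac{\#\{0\le i\le k-1 : T^{(i)}(n)\text{ is odd}\}}{k},$$ i.e. the proportion of ones in the parity sequence $\left(T^{(i)}(n) \bmod 2\right)_{0\le i\le k-1}$. *)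

(* Defs.v *)
From Stdlib Require Import Reals ZArith List Lia ClassicalEpsilon Finite_sets.
From Coquelicot Require Import Rbar.

Definition T (n : Z) : Z :=
  (if Z.even n then n / 2 else (3 * n + 1) / 2)%Z.

Definition reaches_one_first_at (n : Z) (k : nat) : Prop :=
  Nat.iter k T n = 1%Z /\ forall j : nat, (j < k)%nat -> Nat.iter j T n <> 1%Z.

(* None stands for an infinite total stopping time. *)
Definition total_stopping_time (n : Z) : option nat :=
  match excluded_middle_informative (exists k, reaches_one_first_at n k) with
  | left H => Some (proj1_sig (constructive_indefinite_description _ H))
  | right _ => None
  end.

Definition convergent (n : Z) : Prop := total_stopping_time n <> None.

Definition odd_count (n : Z) (k : nat) : nat :=
  length (filter (fun i => Z.odd (Nat.iter i T n)) (seq 0 k)).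

(* Meaningful for convergent n >= 2; the value 0 on a divergent trajectory is
   arbitrary, and for n = 1 the quotient is 0 * / 0 = 0. *)
Definition ones_ratio (n : Z) : R :=
  match total_stopping_time n with
  | Some k => (INR (odd_count n k) / INR k)%R
  | None => 0%R
  end.

(* Meaningful for n >= 2; for n = 1 the quotient is 0 * / ln 1 = 0. *)
Definition stopping_time_ratio (n : Z) : Rbar :=
  match total_stopping_time n with
  | Some k => Rbar.Finite (INR k / ln (IZR n))
  | None => p_infty
  end.

Definition infinite_set (P : Z -> Prop) : Prop := ~ Finite_sets.Finite Z P.

Lemma reaches_one_first_at_unique (n : Z) (j k : nat) :
  reaches_one_first_at n j -> reaches_one_first_at n k -> j = k.
Proof.
  intros [Hj Hj'] [Hk Hk'].
  destruct (Nat.lt_trichotomy j k) as [H | [H | H]].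
  - now destruct (Hk' j H).
  - exact H.
  - now destruct (Hj' k H).
Qed.

Lemma total_stopping_time_Some (n : Z) (k : nat) :
  total_stopping_time n = Some k <-> reaches_one_first_at n k.
Proof.
  unfold total_stopping_time.
  destruct (excluded_middle_informative _) as [H | H].
  - destruct (constructive_indefinite_description _ H) as [j Hj]; simpl.
    split.
    + intros E; injection E as <-; exact Hj.
    + intros Hk; now rewrite (reaches_one_first_at_unique n j k Hj Hk).
  - split; [discriminate | intros Hk; destruct H; now exists k].
Qed.

Lemma total_stopping_time_None (n : Z) :
  total_stopping_time n = None <-> forall k : nat, Nat.iter k T n <> 1%Z.
Proof.
  split.
  - intros E k.
    induction k as [k IH] using (well_founded_induction Wf_nat.lt_wf).
    intros Hk.
    assert (H : reaches_one_first_at n k) by (split; assumption).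
    apply total_stopping_time_Some in H; congruence.
  - intros H; destruct (total_stopping_time n) as [k |] eqn:E; [| reflexivity].
    apply total_stopping_time_Some in E; now destruct (H k (proj1 E)).
Qed.

(* Main.v *)
Require Import Defs.
From Stdlib Require Import Reals ZArith.
From Coquelicot Require Import Rbar.
From Coquelicot Require Import Coquelicot.
From Stdlib Require Import List Lia Lra Bool Finite_sets.
Import ListNotations.

(** Why the theorem is true.

    Weigh a trajectory that reaches 1 after k steps, i of them odd, by
    29 i - 14 k: its ones-ratio is at least 14/29 exactly when this weight is
    nonnegative.  Trajectories are lengthened at their beginning.  A number n
    always has the predecessor 2n under T, at a loss of 14, and if n = 2 mod 3
    it has the odd predecessor (2n-1)/3, at a gain of 29 - 14 = 15.  So it is
    enough to climb the tree of predecessors of one number for ever without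
    letting the weight drift to minus infinity.

    Which moves are possible depends on the 3-adic digits of n.  An odd move
    consumes the lowest digit, so that any fixed number of digits is soon used
    up, and the digits above them have to be regarded as chosen by an opponent.
    The climb is a game against this opponent.  It is won with the help of a
    potential: a function v on the classes modulo 3^5 prime to 3 such that
    every n in such a class has a proper iterated predecessor m, in a class of
    the same kind, for which

        (weight gained from n to m) >= v(m) - v(n).

    Then weight - v never decreases along the climb, and a start whose weight
    is at least v(start) yields infinitely many numbers of weight at least
    v >= 0.  The number 31 is such a start: it needs 67 steps, 39 of them odd,
    and has weight 193.

    That a given table of values is a potential is a finite statement, because
    the path from n to m may be chosen after finitely many digits of n are
    known.  A strategy is a decision tree: it asks for the next digit of n,
    extends some of the paths considered so far, and stops as soon as one of
    them has arrived at a class of sufficiently small potential.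
    [all_win_sound] says that a strategy that passes the test [all_win] proves
    the inequality above for all integers of its class, and
    [strategies_win] runs the test on strategies with some hundred thousand
    nodes, which are found by an unverified tree search ([search]).  The
    potential is what keeps the trees small: if every climb from n to m had to
    gain a nonnegative weight without regard to the class in which it ends, much
    larger trees would be necessary.

    The bound on the stopping time ratio follows from the ones-ratio since
    n 3^i <= 2^k whenever n reaches 1 in k steps with i odd ones
    ([iter_T_bound]); it remains to estimate 29 log 2 - 14 log 3, the logarithm
    of 2^29 / 3^14 ([log_gap_bounds]). *)

Open Scope Z_scope.

(** * Predecessors under T *)

Lemma T_double x : T (2 * x) = x.
Proof.
  unfold T. rewrite Z.even_mul. cbn [Z.even orb].
  rewrite Z.mul_comm. now apply Z.div_mul.
Qed.

Lemma T_odd x n : Z.odd x = true -> 3 * x + 1 = 2 * n -> T x = n.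
Proof.
  intros Ho H. unfold T. rewrite <- Z.negb_odd, Ho, H. cbn [negb].
  rewrite Z.mul_comm. now apply Z.div_mul.
Qed.

Lemma iter_T_succ k n : Nat.iter (S k) T n = Nat.iter k T (T n).
Proof. apply Nat.iter_succ_r. Qed.

Lemma odd_count_succ n k :
  odd_count n (S k) = ((if Z.odd n then 1 else 0) + odd_count (T n) k)%nat.
Proof.
  unfold odd_count. cbn [seq filter]. rewrite <- seq_shift.
  assert (H : forall l,
    length (filter (fun i => Z.odd (Nat.iter i T n)) (map S l)) =
    length (filter (fun i => Z.odd (Nat.iter i T (T n))) l)).
  { induction l as [|i l IH]; [reflexivity|].
    cbn [map filter]. rewrite iter_T_succ.
    destruct (Z.odd (Nat.iter i T (T n))); cbn [length]; now rewrite IH. }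
  cbn [Nat.iter nat_rect]. destruct (Z.odd n); cbn [length]; now rewrite H.
Qed.

Lemma odd_count_add n j k :
  odd_count n (j + k) = (odd_count n j + odd_count (Nat.iter j T n) k)%nat.
Proof.
  revert n. induction j as [|j IH]; intros n; [reflexivity|].
  rewrite Nat.add_succ_l, !odd_count_succ, IH, iter_T_succ. lia.
Qed.

Definition backward (n : Z) (k i : nat) (m : Z) : Prop :=
  Nat.iter k T m = n /\ odd_count m k = i /\ 1 <= m.

Lemma backward_refl n : 1 <= n -> backward n 0 0 n.
Proof. now repeat split. Qed.

Lemma backward_even n k i m : backward n k i m -> backward n (S k) i (2 * m).
Proof.
  intros (H1 & H2 & H3). repeat split; [| |lia].
  - now rewrite iter_T_succ, T_double.
  - rewrite odd_count_succ, T_double, Z.odd_mul. exact H2.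
Qed.

(** The odd predecessor of m = 2 + 3x is (2m-1)/3 = 2x + 1.  In ternary, it
    arises by deleting the lowest digit 2 and doubling with incoming carry 1,
    so that it can be treated like the even predecessor 2m. *)
Lemma backward_odd n k i x :
  backward n k i (2 + 3 * x) -> backward n (S k) (S i) (2 * x + 1).
Proof.
  intros (H1 & H2 & H3).
  assert (Ho : Z.odd (2 * x + 1) = true) by now rewrite Z.odd_add, Z.odd_mul.
  assert (HT : T (2 * x + 1) = 2 + 3 * x) by (apply T_odd; [exact Ho | ring]).
  repeat split; [| |lia].
  - now rewrite iter_T_succ, HT.
  - now rewrite odd_count_succ, HT, Ho, H2.
Qed.

(** * Doubling in base 3 *)

Inductive digit := D0 | D1 | D2.

Definition digit_val (d : digit) : Z :=
  match d with D0 => 0 | D1 => 1 | D2 => 2 end.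

Definition carry_val (c : bool) : Z := if c then 1 else 0.

(** One cell of a doubling circuit: 2 d + c written as an output digit and an
    outgoing carry. *)
Definition cell (c : bool) (d : digit) : digit * bool :=
  match c, d with
  | false, D0 => (D0, false)
  | false, D1 => (D2, false)
  | false, D2 => (D1, true)
  | true, D0 => (D1, false)
  | true, D1 => (D0, true)
  | true, D2 => (D2, true)
  end.

Lemma cell_val c d : let (o, c') := cell c d in
  2 * digit_val d + carry_val c = digit_val o + 3 * carry_val c'.
Proof. now destruct c, d. Qed.

(** The lowest digit comes first, since carries move upwards; h collects the
    digits that are not listed. *)
Fixpoint low_digits (w : list digit) (h : Z) : Z :=
  match w with [] => h | d :: w' => digit_val d + 3 * low_digits w' h end.

Lemma low_digits_app w w' h :
  low_digits (w ++ w') h = low_digits w (low_digits w' h).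
Proof. induction w as [|d w IH]; cbn; [reflexivity | now rewrite IH]. Qed.

Lemma lowest_digit D : exists d D', D = digit_val d + 3 * D'.
Proof.
  pose proof (Z.div_mod D 3 ltac:(lia)) as H.
  pose proof (Z.mod_pos_bound D 3 ltac:(lia)).
  assert (D mod 3 = 0 \/ D mod 3 = 1 \/ D mod 3 = 2) as [E|[E|E]] by lia;
    [exists D0 | exists D1 | exists D2]; exists (D / 3); cbn [digit_val]; lia.
Qed.

Fixpoint double (w : list digit) (c : bool) : list digit * bool :=
  match w with
  | [] => ([], c)
  | d :: w' =>
      let (o, c') := cell c d in
      let (w'', c'') := double w' c' in (o :: w'', c'')
  end.

Lemma double_val w : forall c h, let (w', c') := double w c in
  low_digits w' (2 * h + carry_val c') = 2 * low_digits w h + carry_val c.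
Proof.
  induction w as [|d w IH]; intros c h; [reflexivity|].
  cbn [double]. pose proof (cell_val c d) as H. destruct (cell c d) as [o c'].
  specialize (IH c' h). destruct (double w c') as [w' c''].
  cbn [low_digits]. lia.
Qed.

(** A pipeline is a cascade of doublings, the most recent one first; each stage
    is represented by the carry that waits in front of its next digit. *)
Fixpoint pipe (cs : list bool) (D : Z) : Z :=
  match cs with [] => D | c :: cs' => 2 * pipe cs' D + carry_val c end.

Fixpoint feed (cs : list bool) (d : digit) : list bool * digit :=
  match cs with
  | [] => ([], d)
  | c :: cs' =>
      let (cs'', e) := feed cs' d in
      let (o, c') := cell c e in (c' :: cs'', o)
  end.

Lemma feed_val cs d D : let (cs', o) := feed cs d in
  pipe cs (digit_val d + 3 * D) = digit_val o + 3 * pipe cs' D.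
Proof.
  induction cs as [|c cs IH]; [reflexivity|].
  cbn [feed]. destruct (feed cs d) as [cs' e].
  pose proof (cell_val c e) as H. destruct (cell c e) as [o c'].
  cbn [pipe]. lia.
Qed.

Lemma feed_length cs d : length (fst (feed cs d)) = length cs.
Proof.
  induction cs as [|c cs IH]; [reflexivity|].
  cbn [feed]. destruct (feed cs d) as [cs' e]. destruct (cell c e).
  cbn in *. lia.
Qed.

(** An iterated predecessor m of a partially known n = r + 3^j D.  The low
    digits of m are known; its remaining part is an affine function of the
    unknown D, namely the output of a pipeline with one stage for each step from
    n to m.  Thus the pipeline also records the number of steps. *)
Inductive numeral := Numeral (w : list digit) (cs : list bool).

Definition num (x : numeral) (D : Z) : Z :=
  let (w, cs) := x in low_digits w (pipe cs D).

Definition steps (x : numeral) : nat := let (_, cs) := x in length cs.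

Definition reveal (d : digit) (x : numeral) : numeral :=
  let (w, cs) := x in let (cs', o) := feed cs d in Numeral (w ++ [o]) cs'.

Definition even_pred (x : numeral) : numeral :=
  let (w, cs) := x in let (w', c) := double w false in Numeral w' (c :: cs).

Definition odd_pred (x : numeral) : option numeral :=
  match x with
  | Numeral (D2 :: w) cs =>
      let (w', c) := double w true in Some (Numeral w' (c :: cs))
  | _ => None
  end.

Lemma num_reveal d x D : num (reveal d x) D = num x (digit_val d + 3 * D).
Proof.
  destruct x as [w cs]. cbn [reveal num].
  pose proof (feed_val cs d D) as H. destruct (feed cs d) as [cs' o].
  cbn [num]. now rewrite low_digits_app, H.
Qed.

Lemma steps_reveal d x : steps (reveal d x) = steps x.
Proof.
  destruct x as [w cs]. cbn. pose proof (feed_length cs d) as H.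
  destruct (feed cs d). exact H.
Qed.

(** * Strategies *)

(** The function of an integer given by finitely many of its low ternary digits;
    [Excluded] marks the classes on which it is not defined. *)
Inductive trie (A : Type) :=
| Excluded
| Class (a : A)
| Split (t0 t1 t2 : trie A).
Arguments Excluded {A}.
Arguments Class {A}.
Arguments Split {A}.

Fixpoint lookup {A} (t : trie A) (w : list digit) : option A :=
  match t, w with
  | Excluded, _ => None
  | Class a, _ => Some a
  | Split t0 t1 t2, d :: w' =>
      lookup match d with D0 => t0 | D1 => t1 | D2 => t2 end w'
  | Split _ _ _, [] => None
  end.

(** A strategy operates on a list of iterated predecessors of n, all of them
    reached with the same number of odd steps.  [Step] replaces the list: the
    pair (j, k) stands for k even predecessors and then an odd one, applied to
    the entry with index j.  [Reveal] asks for the next digit of n.  [Done]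
    claims that the head of the list has reached its goal. *)
Inductive strategy :=
| Done
| Step (moves : list (nat * nat)) (s : strategy)
| Reveal (s0 s1 s2 : strategy).

Fixpoint move (k : nat) (x : numeral) : option numeral :=
  match k with O => odd_pred x | S k' => move k' (even_pred x) end.

Fixpoint follow (moves : list (nat * nat)) (xs : list numeral) : list numeral :=
  match moves with
  | [] => []
  | (j, k) :: moves' =>
      match nth_error xs j with
      | Some x =>
          match move k x with
          | Some y => y :: follow moves' xs
          | None => follow moves' xs
          end
      | None => follow moves' xs
      end
  end.

(** [credit] is the potential of n plus 29 for every odd step made so far; the
    loss of 14 per step is only charged at the end, where the number of steps can
    be read off the pipeline. *)
Fixpoint wins (phi : trie Z) (credit : Z) (s : strategy) (xs : list numeral)
  : bool :=
  match s with
  | Done =>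
      match xs with
      | Numeral w cs :: _ =>
          match lookup phi w with
          | Some v =>
              let k := Z.of_nat (length cs) in
              (0 <? k) && (v + 14 * k <=? credit)
          | None => false
          end
      | [] => false
      end
  | Step moves s' => wins phi (credit + 29) s' (follow moves xs)
  | Reveal s0 s1 s2 =>
      wins phi credit s0 (map (reveal D0) xs) &&
      (wins phi credit s1 (map (reveal D1) xs) &&
       wins phi credit s2 (map (reveal D2) xs))
  end.

(** [p] is the subtree of [phi] that belongs to the class with low digits
    [rev w]. *)
Fixpoint all_win (phi p : trie Z) (t : trie strategy) (w : list digit) : bool :=
  match p, t with
  | Excluded, _ => true
  | Class v, Class s => wins phi v s [Numeral (rev w) []]
  | Split p0 p1 p2, Split t0 t1 t2 =>
      all_win phi p0 t0 (D0 :: w) &&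
      (all_win phi p1 t1 (D1 :: w) && all_win phi p2 t2 (D2 :: w))
  | _, _ => false
  end.

(** * Soundness of the test *)

Definition predecessor (n : Z) (i : nat) (D : Z) (x : numeral) : Prop :=
  backward n (steps x) i (num x D).

Lemma predecessor_reveal n i d D xs :
  Forall (predecessor n i (digit_val d + 3 * D)) xs ->
  Forall (predecessor n i D) (map (reveal d) xs).
Proof.
  intros H. apply Forall_map. eapply Forall_impl; [|exact H]. intros x.
  unfold predecessor. now rewrite num_reveal, steps_reveal.
Qed.

Lemma predecessor_even n i D x :
  predecessor n i D x -> predecessor n i D (even_pred x).
Proof.
  unfold predecessor. destruct x as [w cs]. cbn [even_pred num steps].
  pose proof (double_val w false (pipe cs D)) as H.
  destruct (double w false) as [w' c]. intros H1.
  apply backward_even in H1. cbn [num steps length pipe].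
  now rewrite H, Z.add_0_r.
Qed.

Lemma predecessor_odd n i D x y :
  odd_pred x = Some y -> predecessor n i D x -> predecessor n (S i) D y.
Proof.
  unfold predecessor. destruct x as [[|[] w] cs]; try discriminate.
  cbn [odd_pred num steps low_digits digit_val].
  pose proof (double_val w true (pipe cs D)) as H.
  destruct (double w true) as [w' c].
  intros [= <-] H1. apply backward_odd in H1. cbn [num steps length pipe].
  now rewrite H.
Qed.

Lemma predecessor_move n i D k : forall x y,
  move k x = Some y -> predecessor n i D x -> predecessor n (S i) D y.
Proof.
  induction k as [|k IH]; intros x y; cbn [move].
  - apply predecessor_odd.
  - intros E H. eapply IH; [exact E|]. now apply predecessor_even.
Qed.

Lemma predecessor_follow n i D moves xs :
  Forall (predecessor n i D) xs -> Forall (predecessor n (S i) D) (follow moves xs).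
Proof.
  intros H. induction moves as [|[j k] moves IH]; [constructor|].
  cbn [follow]. destruct (nth_error xs j) as [x|] eqn:Ex; [|exact IH].
  destruct (move k x) as [y|] eqn:Ey; [|exact IH].
  constructor; [|exact IH]. eapply predecessor_move; [exact Ey|].
  eapply Forall_forall; [exact H|]. eapply nth_error_In. exact Ex.
Qed.

Definition climbs (phi : trie Z) (credit : Z) (i : nat) (n : Z) : Prop :=
  exists k i' m w D v,
    (0 < k)%nat /\ backward n k i' m /\
    m = low_digits w D /\ lookup phi w = Some v /\
    v + 14 * Z.of_nat k <= credit + 29 * (Z.of_nat i' - Z.of_nat i).

Lemma wins_sound phi s : forall credit xs n i D,
  wins phi credit s xs = true -> Forall (predecessor n i D) xs ->
  climbs phi credit i n.
Proof.
  induction s as [|moves s IH|s0 IH0 s1 IH1 s2 IH2];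
    intros credit xs n i D Hw Hx; cbn [wins] in Hw.
  - destruct xs as [|[w cs] xs]; [discriminate|].
    destruct (lookup phi w) as [v|] eqn:E; [|discriminate].
    apply andb_true_iff in Hw as [Hk Hw].
    apply Z.ltb_lt in Hk. apply Z.leb_le in Hw. inversion_clear Hx.
    exists (length cs), i, (num (Numeral w cs) D), w, (pipe cs D), v.
    repeat split; try apply H; auto; lia.
  - apply (IH _ _ n (S i) D) in Hw; [|now apply predecessor_follow].
    destruct Hw as (k & i' & m & w & D' & v & Hk & H1 & H2 & H3 & H4).
    exists k, i', m, w, D', v. repeat split; try apply H1; auto; lia.
  - apply andb_true_iff in Hw as [Hw0 Hw]. apply andb_true_iff in Hw as [Hw1 Hw2].
    destruct (lowest_digit D) as ([] & D' & ->).
    + eapply (IH0 _ _ n i D'); [exact Hw0|]. now apply predecessor_reveal.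
    + eapply (IH1 _ _ n i D'); [exact Hw1|]. now apply predecessor_reveal.
    + eapply (IH2 _ _ n i D'); [exact Hw2|]. now apply predecessor_reveal.
Qed.

Lemma all_win_sound phi t : all_win phi phi t [] = true ->
  forall n w D v, 1 <= n -> n = low_digits w D -> lookup phi w = Some v ->
  climbs phi v 0 n.
Proof.
  assert (H : forall p t w0, all_win phi p t w0 = true ->
    forall n w D v, 1 <= n -> n = low_digits (rev w0 ++ w) D ->
    lookup p w = Some v -> climbs phi v 0 n).
  { clear t. induction p as [|v|p0 IH0 p1 IH1 p2 IH2];
      intros [|s|t0 t1 t2] w0 Hp n w D v' Hn En El; try discriminate; cbn in Hp.
    - injection El as <-. rewrite low_digits_app in En.
      apply (wins_sound _ _ _ _ n 0 (low_digits w D)) in Hp; [exact Hp|].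
      constructor; [|constructor]. unfold predecessor.
      cbn [num steps pipe length]. rewrite <- En. now apply backward_refl.
    - apply andb_true_iff in Hp as [Hp0 Hp]. apply andb_true_iff in Hp as [Hp1 Hp2].
      destruct w as [|d w]; [discriminate|].
      replace (rev w0 ++ d :: w) with (rev (d :: w0) ++ w) in En
        by (cbn; now rewrite <- app_assoc).
      destruct d; cbn [lookup] in El; eauto. }
  intros Ht n w D v. exact (H phi t [] Ht n w D v).
Qed.

(** * The potential and the strategies *)

(** The values of the potential on the classes 0, ..., 242 modulo 3^5, where the
    multiples of 3 have a dummy entry 0.  They come from a numerical optimization
    of the total size of the strategies.  A high value means that a climb from the
    class may have to begin with many doublings. *)
Definition potential_table : list Z :=
  [0; 49; 35; 0; 53; 42; 0; 70; 35; 0; 28; 45; 0; 29; 56; 0; 85; 30;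
   0; 45; 14; 0; 53; 85; 0; 98; 15; 0; 42; 54; 0; 79; 68; 0; 96; 70;
   0; 43; 31; 0; 44; 58; 0; 70; 29; 0; 57; 30; 0; 60; 84; 0; 83; 45;
   0; 75; 28; 0; 84; 55; 0; 91; 65; 0; 57; 41; 0; 52; 82; 0; 87; 16;
   0; 76; 29; 0; 17; 79; 0; 111; 30; 0; 44; 51; 0; 69; 56; 0; 84; 50;
   0; 22; 45; 0; 28; 45; 0; 84; 30; 0; 69; 18; 0; 27; 69; 0; 84; 1;
   0; 45; 44; 0; 73; 57; 0; 94; 70; 0; 31; 42; 0; 29; 68; 0; 56; 27;
   0; 67; 43; 0; 44; 59; 0; 97; 40; 0; 68; 17; 0; 84; 73; 0; 72; 55;
   0; 52; 65; 0; 69; 89; 0; 67; 3; 0; 64; 26; 0; 42; 97; 0; 96; 0;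
   0; 67; 30; 0; 62; 36; 0; 59; 55; 0; 32; 41; 0; 15; 70; 0; 71; 29;
   0; 56; 6; 0; 50; 85; 0; 73; 14; 0; 31; 44; 0; 64; 70; 0; 103; 58;
   0; 42; 44; 0; 14; 80; 0; 53; 13; 0; 55; 29; 0; 43; 70; 0; 99; 41;
   0; 66; 28; 0; 71; 58; 0; 102; 67; 0; 43; 44; 0; 59; 80; 0; 72; 14;
   0; 71; 22; 0; 28; 85; 0; 99; 15].

Fixpoint trie_of_table (table : list Z) (depth r m : nat) : trie Z :=
  match depth with
  | O => Class (nth r table 0)
  | S depth' =>
      Split (trie_of_table table depth' r (3 * m))
            (trie_of_table table depth' (r + m) (3 * m))
            (trie_of_table table depth' (r + 2 * m) (3 * m))
  end.

(** Multiples of 3 are excluded, because their only predecessors are even. *)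
Definition potential : trie Z := Eval vm_compute in
  Split Excluded (trie_of_table potential_table 4 1 3)
                 (trie_of_table potential_table 4 2 3).

Fixpoint nonneg (t : trie Z) : bool :=
  match t with
  | Excluded => true
  | Class v => 0 <=? v
  | Split t0 t1 t2 => nonneg t0 && (nonneg t1 && nonneg t2)
  end.

Lemma nonneg_lookup t : nonneg t = true ->
  forall w v, lookup t w = Some v -> 0 <= v.
Proof.
  induction t as [|v|t0 IH0 t1 IH1 t2 IH2]; intros Ht w v' E; cbn in Ht.
  - discriminate.
  - injection E as <-. now apply Z.leb_le.
  - apply andb_true_iff in Ht as [H0 H]. apply andb_true_iff in H as [H1 H2].
    destruct w as [|[] w]; [discriminate| | |]; cbn [lookup] in E; eauto.
Qed.

Lemma potential_nonneg w v : lookup potential w = Some v -> 0 <= v.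
Proof. apply nonneg_lookup. reflexivity. Qed.

(** The tree search that finds the strategies.  It keeps many iterated
    predecessors at a time, each with its current balance: the potential of n
    plus the weight gained so far.  What an entry lacks is the difference between
    the potential of its class and its balance; the goal is reached when nothing
    is lacking.  Entries that lack too much are dropped, since they hardly ever
    contribute. *)
Definition entry := (numeral * Z)%type.

Definition max_lack : Z := 75.
Definition min_balance : Z := (-60).
Definition max_entries : nat := 25.

(** A move, the entry to which it leads, and what this entry lacks. *)
Definition candidate := (nat * nat * entry * Z)%type.

(** The moves (j, k), (j, k+1), ... of the entry with index j; [balance] already
    contains the gain of the final odd step. *)
Fixpoint candidates_from (j k fuel : nat) (x : numeral) (balance : Z)
  (acc : list candidate) : list candidate :=
  match fuel with
  | O => acc
  | S fuel' =>
      if balance <? min_balance then acc else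
      candidates_from j (S k) fuel' (even_pred x) (balance - 14)
        match odd_pred x with
        | Some (Numeral w _ as y) =>
            match lookup potential w with
            | Some v =>
                let lack := v - balance in
                if lack <=? max_lack then ((j, k), (y, balance), lack) :: acc
                else acc
            | None => acc
            end
        | None => acc
        end
  end.

Fixpoint candidates (j : nat) (es : list entry) (acc : list candidate)
  : list candidate :=
  match es with
  | [] => acc
  | (x, balance) :: es' =>
      candidates (S j) es' (candidates_from j 0 9 x (balance + 15) acc)
  end.

(** Lowers the admitted lack until at most [max_entries] candidates remain. *)
Fixpoint shrink (fuel : nat) (bound : Z) (l : list candidate) : list candidate :=
  match fuel with
  | O => l
  | S fuel' =>
      if (length l <=? max_entries)%nat then l else
      let bound' := bound - 8 in
      shrink fuel' bound' (filter (fun c => snd c <=? bound') l)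
  end.

Fixpoint position (j : nat) (l : list nat) : nat :=
  match l with
  | [] => O
  | x :: l' => if (x =? j)%nat then O else S (position j l')
  end.

(** The result consists of the moves of the first step and the strategy
    afterwards.  The strategy retains only those entries that are used in one of
    the three subtrees, which shortens the lists drastically; the indices in the
    first steps of the subtrees are renumbered accordingly. *)
Fixpoint search (fuel : nat) (es : list entry)
  : option (list (nat * nat) * strategy) :=
  match fuel with
  | O => None
  | S fuel' =>
      let cs := candidates 0 es [] in
      match find (fun c => snd c <=? 0) cs with
      | Some (m, _, _) => Some ([m], Done)
      | None =>
          let kept := shrink 20 max_lack cs in
          let next d := search fuel'
            (map (fun c : candidate =>
                    let '(_, (x, balance), _) := c in (reveal d x, balance)) kept) in
          match next D0 with None => None | Some (m0, s0) =>
          match next D1 with None => None | Some (m1, s1) =>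
          match next D2 with None => None | Some (m2, s2) =>
            let used := filter
              (fun c => existsb (fun m => (fst c =? fst m)%nat) (m0 ++ m1 ++ m2))
              (combine (seq 0 (length kept)) kept) in
            let renumber := map (fun m : nat * nat =>
              (position (fst m) (map fst used), snd m)) in
            Some (map (fun c => fst (fst (snd c))) used,
                  Reveal (Step (renumber m0) s0)
                         (Step (renumber m1) s1)
                         (Step (renumber m2) s2))
          end end end
      end
  end.

Definition find_strategy (v : Z) (w : list digit) : strategy :=
  let next d := search 30 [(reveal d (Numeral w []), v)] in
  match next D0, next D1, next D2 with
  | Some (m0, s0), Some (m1, s1), Some (m2, s2) =>
      Reveal (Step m0 s0) (Step m1 s1) (Step m2 s2)
  | _, _, _ => Done
  end.

Fixpoint find_strategies (p : trie Z) (w : list digit) : trie strategy :=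
  match p with
  | Excluded => Excluded
  | Class v => Class (find_strategy v (rev w))
  | Split p0 p1 p2 =>
      Split (find_strategies p0 (D0 :: w))
            (find_strategies p1 (D1 :: w))
            (find_strategies p2 (D2 :: w))
  end.

(* Finding the strategies takes much longer than testing them; the normal form
   keeps the result of the search. *)
Definition strategies : trie strategy :=
  Eval vm_compute in find_strategies potential [].

Lemma strategies_win : all_win potential potential strategies [] = true.
Proof. vm_cast_no_check (eq_refl true). Qed.

(** * The climb *)

Lemma iter_T_small n k : 1 <= n <= 2 -> 1 <= Nat.iter k T n <= 2.
Proof.
  intros H. induction k as [|k IH]; [exact H|].
  rewrite Nat.iter_succ.
  assert (Nat.iter k T n = 1 \/ Nat.iter k T n = 2) as [-> | ->] by lia; cbn; lia.
Qed.

(** The lengthened trajectory does not meet 1 too early: from 1, it could never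
    leave the cycle (1 2), which does not contain n. *)
Lemma reaches_one_backward n k k' i' m :
  3 <= n -> reaches_one_first_at n k -> backward n k' i' m ->
  3 <= m /\ reaches_one_first_at m (k' + k).
Proof.
  intros Hn [H1 Hmin] (Hm & _ & Hpos).
  assert (Hsmall : forall j, (j <= k')%nat -> ~ (1 <= Nat.iter j T m <= 2)).
  { intros j Hj Hs. apply (iter_T_small _ (k' - j)) in Hs.
    rewrite <- Nat.iter_add, Nat.sub_add, Hm in Hs by exact Hj. lia. }
  split.
  { pose proof (Hsmall 0%nat (Nat.le_0_l _)) as H0.
    change (Nat.iter 0 T m) with m in H0. lia. }
  split.
  - now rewrite Nat.add_comm, Nat.iter_add, Hm.
  - intros j Hj. destruct (Nat.le_gt_cases k' j) as [Hle|Hlt].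
    + replace j with (j - k' + k')%nat by lia. rewrite Nat.iter_add, Hm.
      apply Hmin. lia.
    + intros E. apply (Hsmall j); lia.
Qed.

(** The invariant of the climb: the weight of n is at least its potential.  As the
    potential is nonnegative, this is stronger than the bound on the ones-ratio,
    which by itself would not survive a sequence of losing moves. *)
Definition funded (n : Z) (k : nat) : Prop :=
  3 <= n /\ reaches_one_first_at n k /\
  exists w D v, n = low_digits w D /\ lookup potential w = Some v /\
    v + 14 * Z.of_nat k <= 29 * Z.of_nat (odd_count n k).

Lemma funded_31 : funded 31 67.
Proof.
  split; [lia|]. split.
  - split; [now vm_compute|].
    assert (H : forallb (fun j => negb (Nat.iter j T 31 =? 1)) (seq 0 67) = true)
      by now vm_compute.
    intros j Hj E. rewrite forallb_forall in H.
    specialize (H j ltac:(apply in_seq; lia)). now rewrite E in H.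
  - (* 31 = 1 + 3 + 27 *)
    eexists [D1; D1; D0; D1; D0], 0, _.
    split; [reflexivity|]. split; [reflexivity|]. now vm_compute.
Qed.

Lemma funded_climb n k : funded n k -> exists m k', (k < k')%nat /\ funded m k'.
Proof.
  intros (Hn & Hr & w & D & v & En & Ev & Hv).
  destruct (all_win_sound _ _ strategies_win n w D v ltac:(lia) En Ev)
    as (k' & i' & m & w' & D' & v' & Hk' & Hb & Em & Ev' & Hv').
  destruct (reaches_one_backward _ _ _ _ _ Hn Hr Hb) as [Hm Hmr].
  exists m, (k' + k)%nat. split; [lia|]. split; [exact Hm|]. split; [exact Hmr|].
  exists w', D', v'. split; [exact Em|]. split; [exact Ev'|].
  destruct Hb as (Hi & Ho & _). rewrite odd_count_add, Hi, Ho. lia.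
Qed.

Lemma funded_unbounded N : exists n k, (N <= k)%nat /\ funded n k.
Proof.
  induction N as [|N (n & k & Hk & Hf)].
  - exists 31, 67%nat. split; [lia | exact funded_31].
  - destruct (funded_climb n k Hf) as (m & k' & Hk' & Hf').
    exists m, k'. split; [lia | exact Hf'].
Qed.

Lemma finite_bounded (P : Z -> Prop) (f : Z -> nat) :
  Finite_sets.Finite Z P -> exists B, forall n, P n -> (f n <= B)%nat.
Proof.
  induction 1 as [|A HA [B HB] x Hx].
  - exists 0%nat. intros n [].
  - exists (Nat.max B (f x)). intros n [y Hy | y Hy].
    + specialize (HB y Hy). lia.
    + destruct Hy. lia.
Qed.

Lemma infinite_if_funded (P : Z -> Prop) :
  (forall n k, funded n k -> P n) -> infinite_set P.
Proof.
  intros HP Hfin.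
  destruct (finite_bounded P
    (fun n => match total_stopping_time n with Some k => k | None => 0%nat end)
    Hfin) as [B HB].
  destruct (funded_unbounded (S B)) as (n & k & Hk & Hf).
  specialize (HB n (HP n k Hf)). destruct Hf as (_ & Hr & _).
  apply total_stopping_time_Some in Hr. rewrite Hr in HB. lia.
Qed.

(** * From the ones-ratio to the stopping time ratio *)

Lemma iter_T_bound n k : 0 <= n ->
  n * 3 ^ Z.of_nat (odd_count n k) <= 2 ^ Z.of_nat k * Nat.iter k T n.
Proof.
  revert n. induction k as [|k IH]; intros n Hn.
  - change (n * 1 <= 1 * n). lia.
  - assert (HT : (if Z.odd n then 3 else 1) * n <= 2 * T n).
    { unfold T. rewrite <- Z.negb_odd. destruct (Z.odd n) eqn:E; cbn [negb].
      - assert (Ho : Z.odd (3 * n + 1) = false)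
          by (rewrite Z.odd_add, Z.odd_mul, E; reflexivity).
        pose proof (Z.div2_odd (3 * n + 1)) as H.
        rewrite Ho, Z.div2_div in H; cbn [Z.b2z] in H. lia.
      - pose proof (Z.div2_odd n) as H.
        rewrite E, Z.div2_div in H; cbn [Z.b2z] in H. lia. }
    specialize (IH (T n) ltac:(destruct (Z.odd n); lia)).
    rewrite iter_T_succ, odd_count_succ, (Nat2Z.inj_succ k), Z.pow_succ_r by lia.
    rewrite Nat2Z.inj_add, Z.pow_add_r by lia.
    assert (0 <= 3 ^ Z.of_nat (odd_count (T n) k)) by (apply Z.pow_nonneg; lia).
    destruct (Z.odd n).
    + change (3 ^ Z.of_nat 1) with 3. nia.
    + change (3 ^ Z.of_nat 0) with 1. nia.
Qed.

Open Scope R_scope.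

Lemma nonneg_of_derive_nonneg (f f' : R -> R) (b : R) :
  (forall t, 0 <= t <= b -> is_derive f t (f' t) /\ 0 <= f' t) ->
  0 <= b -> 0 <= f 0 -> 0 <= f b.
Proof.
  intros Hf Hb H0.
  destruct (MVT_gen f 0 b f') as (c & Hc & E).
  - intros t Ht. apply Hf. rewrite Rmin_left, Rmax_right in Ht; lra.
  - intros t Ht. rewrite Rmin_left, Rmax_right in Ht by lra.
    apply continuity_pt_filterlim, (ex_derive_continuous f).
    exists (f' t). now apply Hf.
  - rewrite Rmin_left, Rmax_right in Hc by lra.
    assert (0 <= f' c * (b - 0))
      by (apply Rmult_le_pos; [now apply Hf | lra]).
    lra.
Qed.

Definition artanh_taylor (y : R) : R :=
  y + y^3/3 + y^5/5 + y^7/7 + y^9/9 + y^11/11 + y^13/13.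

(** Both differences vanish at 0 and have a nonnegative derivative on [0, b]:
    the derivative of ln (1 + t) - ln (1 - t) is 2 / (1 - t^2), and its
    geometric series has the remainder 2 t^14 / (1 - t^2). *)
Lemma artanh_bounds (b : R) : 0 <= b < 1 ->
  2 * artanh_taylor b <= ln (1 + b) - ln (1 - b)
    <= 2 * artanh_taylor b + 2 * b^15 / (15 * (1 - b^2)).
Proof.
  intros Hb.
  assert (Hd : 0 < 1 - b^2) by nra.
  assert (A : 0 <= ln (1 + b) - ln (1 - b) - 2 * artanh_taylor b).
  { apply (nonneg_of_derive_nonneg
      (fun t => ln (1 + t) - ln (1 - t) - 2 * artanh_taylor t)
      (fun t => 2 * t^14 / (1 - t^2)) b); [|lra|].
    - intros t Ht. assert (0 < 1 - t^2) by nra. split.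
      + unfold artanh_taylor. auto_derive; [lra|]. field. nra.
      + apply Rmult_le_pos; [|now left; apply Rinv_0_lt_compat].
        pose proof (pow_le t 14 (proj1 Ht)). lra.
    - unfold artanh_taylor. rewrite Rplus_0_r, Rminus_0_r, ln_1. lra. }
  assert (B : 0 <= 2 * b^15 / (15 * (1 - b^2))
    - (ln (1 + b) - ln (1 - b) - 2 * artanh_taylor b)).
  { apply (nonneg_of_derive_nonneg
      (fun t => 2 * t^15 / (15 * (1 - b^2))
         - (ln (1 + t) - ln (1 - t) - 2 * artanh_taylor t))
      (fun t => 2 * t^14 * (/ (1 - b^2) - / (1 - t^2))) b); [|lra|].
    - intros t Ht. assert (0 < 1 - t^2) by nra. split.
      + unfold artanh_taylor. auto_derive; [lra|]. field. nra.
      + apply Rmult_le_pos; [pose proof (pow_le t 14 (proj1 Ht)); lra|].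
        assert (/ (1 - t^2) <= / (1 - b^2)) by (apply Rinv_le_contravar; nra).
        lra.
    - unfold artanh_taylor. rewrite Rplus_0_r, Rminus_0_r, ln_1.
      replace (2 * 0 ^ 15 / (15 * (1 - b ^ 2))) with 0 by (field; lra). lra. }
  lra.
Qed.

Lemma log_gap_bounds : 4.720694 <= 29 * ln 2 - 14 * ln 3 <= 4.720701.
Proof.
  (* 2^29 / 3^14 = 2^7 / q for q = 3^14 / 2^22, which is close to 1; so the
     series converge fast for 2 = (1 + 1/3) / (1 - 1/3) and
     q = (1 + y) / (1 - y). *)
  set (y := 588665 / 8977273).
  assert (E2 : ln (1 + /3) - ln (1 - /3) = ln 2).
  { rewrite <- ln_div by lra. f_equal. lra. }
  assert (Eq : ln (1 + y) - ln (1 - y) = 14 * ln 3 - 22 * ln 2).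
  { unfold y. rewrite <- ln_div by lra.
    replace 14 with (INR 14) by (simpl; lra).
    replace 22 with (INR 22) by (simpl; lra).
    rewrite <- !ln_pow, <- ln_div by (try apply pow_lt; lra).
    f_equal. field_simplify; lra. }
  pose proof (artanh_bounds (/3) ltac:(lra)) as H1.
  pose proof (artanh_bounds y ltac:(unfold y; lra)) as H2.
  rewrite E2 in H1. rewrite Eq in H2.
  unfold artanh_taylor, y in *. lra.
Qed.

Lemma funded_weight n k : funded n k -> 14 * INR k <= 29 * INR (odd_count n k).
Proof.
  intros (_ & _ & w & D & v & _ & Ev & Hv). apply potential_nonneg in Ev.
  rewrite !INR_IZR_INZ, <- !mult_IZR. apply IZR_le. lia.
Qed.

Lemma funded_ones_ratio n k : funded n k -> ones_ratio n >= 14 / 29.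
Proof.
  intros Hf. pose proof (funded_weight n k Hf) as Hw.
  destruct Hf as (Hn & Hr & _). unfold ones_ratio.
  rewrite (proj2 (total_stopping_time_Some n k) Hr).
  assert (Hk : 0 < INR k).
  { apply lt_0_INR. destruct k; [|lia]. destruct Hr as [H _]. cbn in H. lia. }
  apply Rle_ge, (Rmult_le_reg_r (INR k)); [exact Hk|].
  replace (INR (odd_count n k) / INR k * INR k)
    with (INR (odd_count n k)) by (field; lra).
  lra.
Qed.

Lemma funded_ln_bound n k : funded n k ->
  29 * ln (IZR n) <= INR k * (29 * ln 2 - 14 * ln 3).
Proof.
  intros Hf. pose proof (funded_weight n k Hf) as Hw.
  destruct Hf as (Hn & [Hr _] & _).
  pose proof (iter_T_bound n k ltac:(lia)) as H. rewrite Hr, Z.mul_1_r in H.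
  apply IZR_le in H. rewrite mult_IZR, <- !pow_IZR in H.
  assert (Hn' : 0 < IZR n) by (apply (IZR_lt 0); lia).
  assert (H3 : 0 < 3 ^ odd_count n k) by (apply pow_lt; lra).
  apply ln_le in H; [|apply Rmult_lt_0_compat; assumption].
  rewrite ln_mult, !ln_pow in H by (assumption || lra).
  assert (0 < ln 3) by (rewrite <- ln_1; apply ln_increasing; lra).
  assert (14 * INR k * ln 3 <= 29 * INR (odd_count n k) * ln 3)
    by (apply Rmult_le_compat_r; lra).
  lra.
Qed.

Lemma funded_stopping_time_ratio n k : funded n k ->
  is_finite (stopping_time_ratio n) /\
  Rbar_le (Rbar.Finite (29 / (29 * ln 2 - 14 * ln 3))) (stopping_time_ratio n).
Proof.
  intros Hf. pose proof (funded_ln_bound n k Hf) as H.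
  destruct Hf as (Hn & Hr & _). unfold stopping_time_ratio.
  rewrite (proj2 (total_stopping_time_Some n k) Hr).
  split; [reflexivity|]. cbn [Rbar_le].
  assert (Hl : 0 < ln (IZR n)).
  { rewrite <- ln_1. apply ln_increasing; [lra|]. apply IZR_lt. lia. }
  pose proof log_gap_bounds.
  apply Rmult_le_reg_r with (ln (IZR n) * (29 * ln 2 - 14 * ln 3));
    [apply Rmult_lt_0_compat; lra|].
  replace (29 / (29 * ln 2 - 14 * ln 3) * (ln (IZR n) * (29 * ln 2 - 14 * ln 3)))
    with (29 * ln (IZR n)) by (field; lra).
  replace (INR k / ln (IZR n) * (ln (IZR n) * (29 * ln 2 - 14 * ln 3)))
    with (INR k * (29 * ln 2 - 14 * ln 3)) by (field; lra).
  exact H.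
Qed.

Theorem theorem1p1 :
  infinite_set (fun n : Z =>
    (1 <= n)%Z /\ convergent n /\ (ones_ratio n >= 14 / 29)%R) /\
  infinite_set (fun n : Z =>
    (1 <= n)%Z /\ is_finite (stopping_time_ratio n) /\
    Rbar_le (Rbar.Finite (29 / (29 * ln 2 - 14 * ln 3))) (stopping_time_ratio n)) /\
  (Rabs (29 / (29 * ln 2 - 14 * ln 3) - 6.14316) <= 0.000005)%R.
Proof.
  split; [|split].
  - apply infinite_if_funded. intros n k Hf. pose proof Hf as (Hn & Hr & _).
    split; [lia|]. split; [|exact (funded_ones_ratio n k Hf)].
    unfold convergent. apply total_stopping_time_Some in Hr. congruence.
  - apply infinite_if_funded. intros n k Hf. pose proof Hf as (Hn & _).
    split; [lia|]. exact (funded_stopping_time_ratio n k Hf).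
  - pose proof log_gap_bounds as H. set (c := 29 * ln 2 - 14 * ln 3) in *.
    assert (E : 29 / c * c = 29) by (field; lra).
    apply Rabs_le. split; nra.
Qed.
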